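(* Let the delays satisfy the independence assumption in the context, and let $\mathfrak{E}$ denote the operator defined in the context, which depends on the set of gains $\mathcal{L}$. Suppose that $\mathcal{L}=\{L_0,\ldots,L_r\}$, together with $\bar{\mathcal{P}}=(\bar P_0,\ldots,\bar P_r)$, solves the optimization problem $$\min_{\mathcal{L},\mathcal{P}}\ \mathrm{tr}\Big(\sum_{j=0}^{r}P_j\pi_j\Big)\quad\text{subject to}\quad \mathfrak{E}\{\mathcal{P}\}-\mathcal{P}\preceq0,$$ over admissible gain sets $\mathcal{L}$ and tuples $\mathcal{P}=(P_0,\ldots,P_r)\succ0$. Then, for any initial condition $\mathcal{P}_0\succeq0$, the iteration $\mathcal{P}_{t+1}=\mathfrak{E}\{\mathcal{P}_t\}$ (with this optimal $\mathcal{L}$) converges to the positive semi-definite solution $\bar{\mathcal{P}}$ of the optimization problem, which is unique (for this $\mathcal{L}$); i.e. $$\lim_{t\to\infty}\mathcal{P}_t=\lim_{t\to\infty}\mathfrak{E}^t\{\mathcal{P}_0\}=\bar{\mathcal{P}}\succeq0,\qquad\text{where }\bar{\mathcal{P}}=\mathfrak{E}\{\bar{\mathcal{P}}\}.$$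
   Context: Data: matrices $A\in\mathbb{R}^{n\times n}$, $B_w\in\mathbb{R}^{n\times n_w}$, rows $c_s\in\mathbb{R}^{1\times n}$ ($s=1,\ldots,n_y$), a covariance matrix $W$ of size $n_w\times n_w$, variances $\sigma_s^2$, and an integer $\bar d\ge0$. Independence assumption on delays: $\tau_s[t]\in\{0,\ldots,\bar d\}\cup\{\infty\}$ are random variables independent over $t$ and $s$, with $\Pr\{\tau_s[t]=d\}=\beta_{s,d}$ for $d=0,\ldots,\bar d$ and all $t$, $\sum_{d=0}^{\bar d}\beta_{s,d}\le1$. Markov chain: $\alpha_{s,d}[t]=1$ if $\tau_s[t-d]=d$ and $0$ otherwise; $\theta_{s,d}[t]=[\alpha_{s,0}[t-d],\alpha_{s,1}[t-d+1],\ldots,\alpha_{s,d}[t]]$; $\theta_s[t]=[\theta_{s,0}[t],\ldots,\theta_{s,\bar d}[t]]$; $\theta[t]=[\theta_1[t],\ldots,\theta_{n_y}[t]]^T$. Each $\theta_{s,d}[t]$ has at most one nonzero entry, so $\theta[t]$ takes values in a finite set $\Theta=\{\vartheta_0,\ldots,\vartheta_r\}$, $r=((\bar d+2)!)^{n_y}-1$, $\vartheta_0=0$. The process $\{\theta[t]\}$ is a Markov chain with $p_{i,j}=\Pr\{\theta[t+1]=\vartheta_j\mid\theta[t]=\vartheta_i\}$, $\Lambda=[p_{i,j}]$; it is ergodic (every state can be reached from every state in finite time), with stationary distribution $\pi=(\pi_0,\ldots,\pi_r)$, $\pi=\pi\Lambda$, all $\pi_j>0$. The matrix $f(\theta[t])=\bigoplus_{s=1}^{n_y}\bigoplus_{d=0}^{\bar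 d}\alpha_{s,d}[t]$ (diagonal; $\bigoplus$ is the direct sum) is a function of $\theta[t]$, so $f(\vartheta_j)$ is defined for each $j$. Augmented matrices: $\bar A$ is the $n(\bar d+1)\times n(\bar d+1)$ matrix with first block row $[A\ 0\cdots0]$, identity blocks on the first block subdiagonal and zeros elsewhere; $\bar B_w=[B_w^T\ 0]^T$; $\bar C$ has rows $[0_{1\times nd}\ \ c_s\ \ 0_{1\times n(\bar d-d)}]$ ordered as the pairs $(s,d)$ in $f$; $V=\bigoplus_{s=1}^{n_y}\bigoplus_{d=0}^{\bar d}\sigma_s^2$. Gains: a gain set is a family $\mathcal{L}=\{L_0,\ldots,L_r\}$ of real matrices of size $n(\bar d+1)\times n_y(\bar d+1)$ indexed by $0,\ldots,r$, with $L_j=0$ when $f(\vartheta_j)=0$. The admissible gain sets may be all of these or may be restricted by constraints on $\mathcal{L}$ (such as equalities $L_i=L_j$ for chosen pairs $i\ne j$); the result does not depend on which constraints on $\mathcal{L}$ are imposed. Set $F_j=I-L_jf(\vartheta_j)\bar C$, $X_j=L_jf(\vartheta_j)$. Operator: for a tuple $\mathcal{P}=(P_0,\ldots,P_r)$ of symmetric $n(\bar d+1)\times n(\bar d+1)$ matrices, $\mathfrak{E}\{\mathcal{P}\}=(\mathfrak{E}_0\{\mathcal{P}\},\ldots,\mathfrak{E}_r\{\mathcal{P}\})$ with $$\mathfrak{E}_j\{\mathcal{P}\}=\sum_{i=0}^{r}p_{i,j}\frac{\pi_i}{\pi_j}\Big(F_j(\bar AP_i\bar A^T+\bar B_wW\bar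 B_w^T)F_j^T+X_jVX_j^T\Big).$$ $\mathfrak{E}^t$ denotes the $t$-fold iterate of $\mathfrak{E}$. Orderings $\preceq,\prec,\succeq,\succ$ between tuples are componentwise Loewner (semidefinite) orderings; e.g. $\mathcal{P}\succ0$ means every $P_i$ is positive definite. *)

(* Defs.v *)
From HB Require Import structures.
From mathcomp Require Import all_boot all_order all_algebra.
From mathcomp Require Import all_classical all_reals all_analysis.
From mathcomp Require Import finmap.

Set Implicit Arguments.
Unset Strict Implicit.
Unset Printing Implicit Defensive.

Import Order.TTheory GRing.Theory Num.Theory.
Import numFieldNormedType.Exports.

Local Open Scope ring_scope.
Local Open Scope classical_set_scope.

Section Loewner.
Variables (R : realType) (m : nat).
Implicit Types A B : 'M[R]_m.

Definition psdmx A : Prop :=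
  A \is symmetricmx /\ forall x : 'rV[R]_m, 0 <= (x *m A *m x^T) 0 0.

Definition pdmx A : Prop :=
  A \is symmetricmx /\ forall x : 'rV[R]_m, x != 0 -> 0 < (x *m A *m x^T) 0 0.

Definition mxle A B : Prop := psdmx (B - A).

End Loewner.

(* Entry i of the row theta_{s,d}, 0 <= i <= d, is indexed by [bit s i] with
   i : 'I_d.+1. *)
Notation bit_index ny dbar := ('I_ny * {d : 'I_dbar.+1 & 'I_d.+1})%type.

Definition bit (ny dbar : nat) (s : 'I_ny) (d : 'I_dbar.+1) (i : 'I_d.+1) :
  bit_index ny dbar := (s, Tagged (fun d : 'I_dbar.+1 => 'I_d.+1) i).

Definition at_most_one (ny dbar : nat) (x : {ffun bit_index ny dbar -> bool}) :=
  [forall s : 'I_ny, forall d : 'I_dbar.+1,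
   forall i : 'I_d.+1, forall i' : 'I_d.+1,
     x (bit s i) && x (bit s i') ==> (i == i')].

(* The finite set Theta.  Its elements vartheta_j are used directly as the
   indices j = 0, ..., r of gains, tuples and transition probabilities. *)
Definition state (ny dbar : nat) : Type :=
  {x : {ffun bit_index ny dbar -> bool} | at_most_one x}.
HB.instance Definition _ ny dbar := Finite.on (state ny dbar).

(* r + 1 = ((dbar + 2)!)^ny *)
Lemma card_state ny dbar : #|{: state ny dbar}| = ((dbar.+2)`! ^ ny)%N.
Proof.
pose T := {dffun forall k : 'I_ny * 'I_dbar.+1, option 'I_k.2.+1}.
pose h (f : T) : {ffun bit_index ny dbar -> bool} :=
  [ffun b : bit_index ny dbar => f (b.1, tag b.2) == Some (tagged b.2)].
have hP f : at_most_one (h f).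
  apply/forallP => s; apply/forallP => d; apply/forallP => i.
  apply/forallP => i'; apply/implyP; rewrite !ffunE /=.
  by move=> /andP[/eqP -> /eqP[->]].
pose g (f : T) : state ny dbar := Sub (h f) (hP f).
pose k (x : state ny dbar) : T :=
  [ffun k : 'I_ny * 'I_dbar.+1 => [pick i | val x (bit k.1 i)]].
have gK : cancel g k.
  move=> f; apply/ffunP => -[s d]; rewrite ffunE /=.
  case: pickP => [i|no] /=; first by rewrite ffunE /= => /eqP.
  case E: (f (s, d)) => [i|//].
  by have := no i; rewrite ffunE /= E eqxx.
have kK : cancel k g.
  move=> x; apply: val_inj; apply/ffunP => -[s [d i]]; rewrite !ffunE /=.
  have /forallP/(_ s)/forallP/(_ d)/forallP x1 := valP x.
  case: pickP => [i' xi'|no] /=; last by rewrite (no i).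
  apply/eqP/idP => [[<-]//|xi].
  have /forallP/(_ i')/implyP := x1 i.
  by rewrite xi' andbT => /(_ xi)/eqP ->.
rewrite -(bij_eq_card (Bijective gK kK)) card_dep_ffun foldrE big_map big_enum /=.
rewrite (eq_bigr (fun k : 'I_ny * 'I_dbar.+1 => k.2.+2)); last first.
  by move=> i _; rewrite card_option card_ord.
rewrite -(pair_bigA _ (fun _ (d : 'I_dbar.+1) => d.+2)) /=.
rewrite prod_nat_const card_ord; congr (_ ^ _)%N.
by elim: dbar {T h hP g k gK kK} => [|m IH];
  rewrite big_ord_recr /= ?big_ord0 // IH [RHS]factS mulnC.
Qed.

(* Random delays.  Time is indexed by [int], so that tau_s[t - d] makes sense
   for every t; the value [None] is the infinite delay. *)
Section Delays.
Context (ny dbar : nat) (Om : Type).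
Variable tau : 'I_ny -> int -> Om -> option 'I_dbar.+1.

Definition alpha (s : 'I_ny) (d : nat) (t : int) (w : Om) : bool :=
  omap (@nat_of_ord dbar.+1) (tau s (t - d%:Z) w) == Some d.

(* theta_{s,d}[t] = [alpha_{s,0}[t-d], alpha_{s,1}[t-d+1], ..., alpha_{s,d}[t]] *)
Definition theta_val (t : int) (w : Om) : {ffun bit_index ny dbar -> bool} :=
  [ffun b : bit_index ny dbar =>
     alpha b.1 (tagged b.2) (t - (tag b.2 : nat)%:Z + (tagged b.2 : nat)%:Z) w].

Lemma theta_subproof t w : at_most_one (theta_val t w).
Proof.
apply/forallP => s; apply/forallP => d; apply/forallP => i.
apply/forallP => i'; apply/implyP; rewrite !ffunE /= /alpha !addrK.
by move=> /andP[/eqP -> /eqP[]] ii'; apply/eqP/val_inj.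
Qed.

Definition theta (t : int) (w : Om) : state ny dbar :=
  Sub (theta_val t w) (theta_subproof t w).

End Delays.

Section Chain.
Context (R : realType) (ny dbar : nat).
Context (disp : measure_display) (Om : measurableType disp).
Variable Pr : probability Om R.
Variable tau : 'I_ny -> int -> Om -> option 'I_dbar.+1.

Definition independent_delays : Prop :=
  forall (J : {fset 'I_ny * int}) (E : 'I_ny * int -> set (option 'I_dbar.+1)),
    Pr (\bigcap_(k in [set` J]) (tau k.1 k.2 @^-1` E k)) =
    (\prod_(k <- J) Pr (tau k.1 k.2 @^-1` E k))%E.

Definition delay_assumption (beta : 'I_ny -> 'I_dbar.+1 -> R) : Prop :=
  [/\ forall s t v, measurable (tau s t @^-1` [set v]),
      independent_delays,
      forall s t d, Pr (tau s t @^-1` [set Some d]) = (beta s d)%:E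
    & forall s, \sum_d beta s d <= 1].

(* Pr{theta[t+1] = j | theta[t] = i}, with value 0 if Pr{theta[t] = i} = 0 *)
Definition cond_prob (t : int) (i j : state ny dbar) : R :=
  fine (Pr (theta tau (t + 1) @^-1` [set j] `&` theta tau t @^-1` [set i])) /
  fine (Pr (theta tau t @^-1` [set i])).

Definition transition_probabilities (p : state ny dbar -> state ny dbar -> R) :=
  forall t i j, p i j = cond_prob t i j.

Definition ergodic (p : state ny dbar -> state ny dbar -> R) : Prop :=
  forall i j, connect (fun k l => 0 < p k l) i j.

Definition stationary (p : state ny dbar -> state ny dbar -> R)
    (pi : state ny dbar -> R) : Prop :=
  [/\ forall j, 0 < pi j, \sum_j pi j = 1 & forall j, pi j = \sum_i pi i * p i j].

End Chain.

(* Dimensions n (dbar + 1) and ny (dbar + 1), in the form required by the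
   block-matrix operations. *)
Notation xdim n dbar := (\sum_(e < dbar.+1) n)%N.
Notation ydim ny dbar := (\sum_(s < ny) \sum_(d < dbar.+1) 1)%N.

Section Estimator.
Context (R : realType) (n nw ny dbar : nat).

Definition fmx (j : state ny dbar) : 'M[R]_(ydim ny dbar) :=
  \mxdiag_(s < ny) \mxdiag_(d < dbar.+1)
    ((val j (bit s (@ord_max d)))%:R%:M : 'M[R]_1).

Lemma fmx_theta (Om : Type) (tau : 'I_ny -> int -> Om -> option 'I_dbar.+1) t w :
  fmx (theta tau t w) =
  \mxdiag_(s < ny) \mxdiag_(d < dbar.+1) ((alpha tau s d t w)%:R%:M : 'M[R]_1).
Proof.
by apply/eq_mxdiag => s; apply/eq_mxdiag => d; rewrite /= ffunE /= subrK.
Qed.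

Definition Abar (A : 'M[R]_n) : 'M[R]_(xdim n dbar) :=
  \mxblock_(k < dbar.+1, l < dbar.+1)
    (if (k == 0%N :> nat) && (l == 0%N :> nat) then A
     else if k == l.+1 :> nat then 1%:M else 0).

Definition Bbar (Bw : 'M[R]_(n, nw)) : 'M[R]_(xdim n dbar, nw) :=
  \mxcol_(k < dbar.+1) (if k == 0%N :> nat then Bw else 0).

Definition Cbar (c : 'I_ny -> 'rV[R]_n) : 'M[R]_(ydim ny dbar, xdim n dbar) :=
  \mxcol_(s < ny) \mxcol_(d < dbar.+1) \mxrow_(l < dbar.+1)
    (if l == d then c s else 0).

Definition Vmx (sigma : 'I_ny -> R) : 'M[R]_(ydim ny dbar) :=
  \mxdiag_(s < ny) \mxdiag_(d < dbar.+1) ((sigma s ^+ 2)%:M : 'M[R]_1).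

Definition gains := state ny dbar -> 'M[R]_(xdim n dbar, ydim ny dbar).
Definition tuples := state ny dbar -> 'M[R]_(xdim n dbar).

Definition gain_set (L : gains) : Prop := forall j, fmx j = 0 -> L j = 0.

Variables (A : 'M[R]_n) (Bw : 'M[R]_(n, nw)) (c : 'I_ny -> 'rV[R]_n).
Variables (W : 'M[R]_nw) (sigma : 'I_ny -> R).
Variables (p : state ny dbar -> state ny dbar -> R) (pi : state ny dbar -> R).

Definition Fmx (L : gains) (j : state ny dbar) : 'M[R]_(xdim n dbar) :=
  1%:M - L j *m fmx j *m Cbar c.

Definition Xmx (L : gains) (j : state ny dbar) :
  'M[R]_(xdim n dbar, ydim ny dbar) := L j *m fmx j.

Definition Eop (L : gains) (P : tuples) : tuples := fun j =>
  \sum_i (p i j * (pi i / pi j)) *: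
    (Fmx L j *m (Abar A *m P i *m (Abar A)^T + Bbar Bw *m W *m (Bbar Bw)^T)
       *m (Fmx L j)^T
     + Xmx L j *m Vmx sigma *m (Xmx L j)^T).

Definition cost (P : tuples) : R := \tr (\sum_j pi j *: P j).

(* [constr] is the arbitrary family of extra constraints on the gain set *)
Definition feasible (constr : gains -> Prop) (L : gains) (P : tuples) : Prop :=
  [/\ gain_set L, constr L, forall j, pdmx (P j)
    & forall j, mxle (Eop L P j - P j) 0].

Definition solves (constr : gains -> Prop) (L : gains) (P : tuples) : Prop :=
  feasible constr L P /\
  forall L' P', feasible constr L' P' -> cost P <= cost P'.

End Estimator.

(* Main.v *)
Require Import Defs.
From HB Require Import structures.
From mathcomp Require Import all_boot all_order all_algebra.
From mathcomp Require Import all_classical all_reals all_analysis.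
From mathcomp Require Import finmap.
From mathcomp Require Import ring lra.

Import Order.TTheory GRing.Theory Num.Theory.
Import numFieldNormedType.Exports.

Local Open Scope ring_scope.
Local Open Scope classical_set_scope.

(** The operator is affine and monotone, E(P) = T(P) + G with G psd.  If Q is psd
    with Q <= Pbar and E(Q) <= Q, then the midpoint of Q and Pbar is feasible, so
    minimality of the trace forces Q = Pbar.  Applied to Q = E(Pbar), this gives
    E(Pbar) = Pbar; applied to the limit of the increasing sequence
    E^t(0) <= Pbar, it gives E^t(0) --> Pbar.  Since Pbar is positive definite,
    P0 <= k Pbar for some k, hence
      E^t(0) <= E^t(P0) <= E^t(0) + k (Pbar - E^t(0)),
    and E^t(P0) --> Pbar.  Matrices are compared and limits taken through their
    quadratic forms; polarization recovers the entries. *)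

Set Implicit Arguments.
Unset Strict Implicit.

Lemma cvg_sumr (R : realType) (I : Type) (r : seq I) (f : I -> nat -> R) (l : I -> R) :
  (forall i, f i t @[t --> \oo] --> l i) ->
  (\sum_(i <- r) f i t) @[t --> \oo] --> \sum_(i <- r) l i.
Proof.
move=> fl; elim: r => [|i r IH].
  by rewrite big_nil; under eq_cvg do rewrite big_nil; exact: cvg_cst.
by rewrite big_cons; under eq_cvg do rewrite big_cons; apply: cvgD.
Qed.

(** * Quadratic forms and polarization *)

Definition quad (R : realType) (m : nat) (A : 'M[R]_m) (x : 'rV[R]_m) : R :=
  (x *m A *m x^T) 0 0.

Section QuadraticForms.
Context (R : realType) (m : nat).
Implicit Types (A B P Q : 'M[R]_m) (x y : 'rV[R]_m) (i j : 'I_m).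

Lemma symmetricmxP A : reflect (A^T = A) (A \is symmetricmx).
Proof.
rewrite is_hermitianmxE expr0 scale1r map_mx_id // eq_sym; exact: eqP.
Qed.

Lemma quad0 x : quad 0 x = 0.
Proof. by rewrite /quad mulmx0 mul0mx mxE. Qed.

Lemma quadD A B x : quad (A + B) x = quad A x + quad B x.
Proof. by rewrite /quad mulmxDr mulmxDl mxE. Qed.

Lemma quadN A x : quad (- A) x = - quad A x.
Proof. by rewrite /quad mulmxN mulNmx mxE. Qed.

Lemma quadZ k A x : quad (k *: A) x = k * quad A x.
Proof. by rewrite /quad -scalemxAr -scalemxAl mxE. Qed.

Lemma quad_sum (I : finType) (F : I -> 'M[R]_m) x :
  quad (\sum_k F k) x = \sum_k quad (F k) x.
Proof. by rewrite /quad mulmx_sumr mulmx_suml summxE. Qed.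

Lemma quad_conj (l : nat) (N : 'M[R]_(m, l)) (A : 'M[R]_l) x :
  quad (N *m A *m N^T) x = quad A (x *m N).
Proof. by rewrite /quad trmx_mul !mulmxA. Qed.

Lemma quadE A x : quad A x = \sum_i \sum_j x 0 i * A i j * x 0 j.
Proof.
rewrite /quad mxE exchange_big /=; apply: eq_bigr => j _.
by rewrite !mxE big_distrl.
Qed.

Lemma quad_delta A i : quad A (delta_mx 0 i) = A i i.
Proof. by rewrite /quad trmx_delta -rowE -colE !mxE. Qed.

Lemma sym_quadDZ A k x y : A^T = A ->
  quad A (x + k *: y) =
  quad A x + 2 * k * (x *m A *m y^T) 0 0 + k ^+ 2 * quad A y.
Proof.
move=> sA; have yx : (y *m A *m x^T) 0 0 = (x *m A *m y^T) 0 0.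
  have <- : (x *m A *m y^T)^T = y *m A *m x^T.
    by rewrite !trmx_mul trmxK sA mulmxA.
  by rewrite [LHS]mxE.
have addE (B C : 'M[R]_1) : (B + C) 0 0 = B 0 0 + C 0 0 by rewrite mxE.
have scaleE h (B : 'M[R]_1) : (h *: B) 0 0 = h * B 0 0 by rewrite mxE.
rewrite /quad linearD linearZ /= !mulmxDr !mulmxDl -!scalemxAr -!scalemxAl.
by rewrite !addE !scaleE yx; ring.
Qed.

Lemma sym_quad_deltaDZ A k i j : A^T = A ->
  quad A (delta_mx 0 i + k *: delta_mx 0 j) =
  A i i + 2 * k * A i j + k ^+ 2 * A j j.
Proof.
by move=> sA; rewrite sym_quadDZ // !quad_delta trmx_delta -rowE -colE !mxE.
Qed.

Lemma sym_polarization A i j : A^T = A ->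
  A i j = (quad A (delta_mx 0 i + delta_mx 0 j)
           - quad A (delta_mx 0 i) - quad A (delta_mx 0 j)) / 2.
Proof.
move=> sA; rewrite !quad_delta -[delta_mx 0 j]scale1r sym_quad_deltaDZ //.
by field.
Qed.

(** * The cone of positive semidefinite matrices *)

Lemma psdmxP A : psdmx A <-> A^T = A /\ forall x, 0 <= quad A x.
Proof. by split=> -[/symmetricmxP]. Qed.

Lemma psd_sym A : psdmx A -> A^T = A.
Proof. by case=> /symmetricmxP. Qed.

Lemma psd_quad_ge0 A x : psdmx A -> 0 <= quad A x.
Proof. by case=> _; apply. Qed.

Lemma pd_psd A : pdmx A -> psdmx A.
Proof.
case=> sA pA; split=> // x; have [->|x0] := eqVneq x 0; last exact/ltW/pA.
by rewrite !mul0mx mxE.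
Qed.

Lemma psdD A B : psdmx A -> psdmx B -> psdmx (A + B).
Proof.
move=> pA pB; apply/psdmxP; split=> [|x].
  by rewrite linearD /= !psd_sym.
by rewrite quadD addr_ge0 // psd_quad_ge0.
Qed.

Lemma psdZ k A : 0 <= k -> psdmx A -> psdmx (k *: A).
Proof.
move=> k0 pA; apply/psdmxP; split=> [|x]; first by rewrite linearZ /= psd_sym.
by rewrite quadZ mulr_ge0 // psd_quad_ge0.
Qed.

Lemma psd0 : psdmx (0 : 'M[R]_m).
Proof. by apply/psdmxP; split=> [|x]; rewrite ?linear0 // quad0. Qed.

Lemma psd_sum (I : finType) (F : I -> 'M[R]_m) :
  (forall k, psdmx (F k)) -> psdmx (\sum_k F k).
Proof.
by move=> pF; apply: (big_ind (@psdmx R m)) => // [|? ?]; [exact: psd0|exact: psdD].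
Qed.

Lemma psd_trace_ge0 A : psdmx A -> 0 <= \tr A.
Proof.
by move=> pA; apply: sumr_ge0 => i _; rewrite -quad_delta psd_quad_ge0.
Qed.

(** The diagonal entries are nonnegative with sum zero, hence all zero. The form at [e_i + e_j] and
    at [e_i - e_j] is then [2 A_ij] and [- 2 A_ij]; both are nonnegative, so [A_ij = 0]. *)
Lemma psd_trace0 A : psdmx A -> \tr A = 0 -> A = 0.
Proof.
move=> pA tA.
have d0 k : A k k = 0.
  apply: (psumr_eq0P _ tA) => // i _.
  by rewrite -quad_delta psd_quad_ge0.
apply/matrixP => i j; rewrite mxE.
have := psd_quad_ge0 (delta_mx 0 i + 1 *: delta_mx 0 j) pA.
have := psd_quad_ge0 (delta_mx 0 i + (-1) *: delta_mx 0 j) pA.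
by rewrite !sym_quad_deltaDZ ?psd_sym // !d0; lra.
Qed.

(** * Domination by a positive definite form *)

Lemma psd_quad_le_sqnorm A : exists2 k, 0 <= k &
  forall x, quad A x <= k * \sum_i x 0 i ^+ 2.
Proof.
(* Every [|x_i x_j|] is at most the squared norm of [x], so the sum of the absolute values of the
   entries serves as [k]. *)
exists (\sum_i \sum_j `|A i j|).
  by apply: sumr_ge0 => i _; apply: sumr_ge0.
move=> x; rewrite quadE mulr_suml; apply: ler_sum => i _.
rewrite mulr_suml; apply: ler_sum => j _.
set S := \sum_(k < m) _.
have leS k : x 0 k ^+ 2 <= S.
  by rewrite /S (bigD1 k) //= lerDl sumr_ge0 // => l _; rewrite sqr_ge0.
have xS : `|x 0 i * x 0 j| <= S.
  have := leS i; have := leS j.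
  rewrite normrM -(real_normK (num_real (x 0 i))) -(real_normK (num_real (x 0 j))).
  have := sqr_ge0 (`|x 0 i| - `|x 0 j|); nra.
rewrite mulrAC [X in X <= _]mulrC (le_trans (ler_norm _)) // normrM.
exact: ler_wpM2l.
Qed.

(* Evaluating [P] at [x - t g], with [g P = e_i] and [t = x_i / (g P g^T)],
   bounds [x_i ^ 2] by a multiple of [x P x^T]. *)
Lemma pd_coord_le P i : pdmx P -> exists2 k, 0 <= k &
  forall x, x 0 i ^+ 2 <= k * quad P x.
Proof.
move=> pP; have [_ pP0] := pP; have sP := psd_sym (pd_psd pP).
(* A nonzero row in the kernel of [P] would be a nonzero zero of the form. *)
have uP : P \in unitmx.
  rewrite -row_free_unit -kermx_eq0; apply/eqP/row_matrixP => k; rewrite row0.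
  apply/eqP/negPn/negP => /pP0.
  by rewrite -row_mul mulmx_ker row0 mul0mx mxE ltxx.
pose g := delta_mx 0 i *m invmx P : 'rV[R]_m.
have gP : g *m P = delta_mx 0 i by rewrite mulmxKV.
have g0 : 0 < quad P g.
  apply: pP0; apply/eqP => g0; have /matrixP/(_ 0 i) := gP.
  by rewrite g0 mul0mx !mxE !eqxx /= => /eqP; rewrite eq_sym oner_eq0.
exists (quad P g); first exact: ltW.
move=> x; pose t := x 0 i / quad P g.
have Pg : P *m g^T = delta_mx i 0.
  by rewrite -[X in X *m _]sP -trmx_mul gP trmx_delta.
have : 0 <= quad P (x - t *: g) by apply/psd_quad_ge0/pd_psd.
rewrite -scaleNr sym_quadDZ // -mulmxA Pg -colE mxE.
rewrite /t => h.
have : 0 <= quad P x - x 0 i ^+ 2 / quad P g.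
  apply: le_trans h _; rewrite le_eqVlt; apply/orP; left; apply/eqP.
  by field; rewrite gt_eqF.
by rewrite subr_ge0 ler_pdivrMr // mulrC.
Qed.

(** The squared norm links the two forms: it bounds [Q] from above, and its terms [x_i ^ 2] are each
    bounded by a multiple of [P]. No eigenvalues or compactness enter. *)
Lemma pd_dominates P Q : pdmx P -> exists2 k, 0 <= k &
  forall x, quad Q x <= k * quad P x.
Proof.
move=> pP; have [q q0 leq] := psd_quad_le_sqnorm Q.
have /choice[k kP] i : exists k, 0 <= k /\ forall x, x 0 i ^+ 2 <= k * quad P x.
  by have [k k0 kP] := pd_coord_le i pP; exists k.
exists (q * \sum_i k i).
  by apply: mulr_ge0 => //; apply: sumr_ge0 => i _; have [] := kP i.
move=> x; apply: le_trans (leq x) _; rewrite -mulrA ler_wpM2l //.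
by rewrite mulr_suml; apply: ler_sum => i _; have [_ ->] := kP i.
Qed.

(** * Convergence of matrices through their forms *)

Lemma cvg_entry_quad (u : nat -> 'M[R]_m) A x :
  (forall i j, u t i j @[t --> \oo] --> A i j) ->
  quad (u t) x @[t --> \oo] --> quad A x.
Proof.
move=> uA; rewrite quadE; under eq_cvg do rewrite quadE.
apply: cvg_sumr => i; apply: cvg_sumr => j.
by apply: cvgMr_tmp; apply: cvgMl_tmp.
Qed.

Lemma cvg_quad_entry (u : nat -> 'M[R]_m) (l : 'rV[R]_m -> R) i j :
  (forall t, (u t)^T = u t) ->
  (forall x, quad (u t) x @[t --> \oo] --> l x) ->
  u t i j @[t --> \oo] --> (l (delta_mx 0 i + delta_mx 0 j)
     - l (delta_mx 0 i) - l (delta_mx 0 j)) / 2.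
Proof.
move=> su ul; under eq_cvg do rewrite (sym_polarization _ _ (su _)).
by apply: cvgMr_tmp; apply: cvgB => //; apply: cvgB.
Qed.

(** A neighbourhood of [A] contains a product of neighbourhoods of its entries, and finitely many
    eventual conditions eventually hold together. *)
Lemma cvg_mx_entry (u : nat -> 'M[R]_m) A :
  (forall i j, u t i j @[t --> \oo] --> A i j) -> u t @[t --> \oo] --> A.
Proof.
move=> uA B [V AV VB]; apply: filterS (_ : \forall t \near \oo,
  forall i j, V i j (u t i j)) => [t Vt|]; first exact: VB.
by apply: filter_forall => i; apply: filter_forall => j; apply/uA/AV.
Qed.

Lemma cvg_quad_mx (u : nat -> 'M[R]_m) A :
  (forall t, (u t)^T = u t) -> A^T = A ->
  (forall x, quad (u t) x @[t --> \oo] --> quad A x) -> u t @[t --> \oo] --> A.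
Proof.
move=> su sA uA; apply: cvg_mx_entry => i j.
by rewrite (sym_polarization _ _ sA); apply: cvg_quad_entry.
Qed.

(** Monotone convergence for symmetric matrices. The pointwise limit [l] of the forms is not known
    in advance to be a quadratic form; polarizing it gives the limits of the entries, and these
    define [A]. *)
Lemma nondecreasing_quad_limit (u : nat -> 'M[R]_m) B :
  (forall t, (u t)^T = u t) ->
  (forall t x, quad (u t) x <= quad (u t.+1) x) ->
  (forall t x, quad (u t) x <= quad B x) ->
  exists2 A, A^T = A & forall x, quad (u t) x @[t --> \oo] --> quad A x.
Proof.
move=> su u1 uB; pose l x := limn (fun t => quad (u t) x).
have ul x : quad (u t) x @[t --> \oo] --> l x.
  apply: nondecreasing_is_cvgn; first by apply/nondecreasing_seqP => t.
  by exists (quad B x) => _ [t _ <-].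
pose A := \matrix_(i < m, j < m) ((l (delta_mx 0 i + delta_mx 0 j)
  - l (delta_mx 0 i) - l (delta_mx 0 j)) / 2).
exists A.
  by apply/matrixP => i j; rewrite !mxE [delta_mx 0 j + _]addrC addrAC.
move=> x; apply: cvg_entry_quad => i j; rewrite mxE.
exact: cvg_quad_entry.
Qed.

End QuadraticForms.

(** * Congruence and block-diagonal sums of psd matrices *)

Lemma psd_conj (R : realType) (m l : nat) (N : 'M[R]_(m, l)) (A : 'M[R]_l) :
  psdmx A -> psdmx (N *m A *m N^T).
Proof.
move=> pA; apply/psdmxP; split=> [|x]; last by rewrite quad_conj psd_quad_ge0.
by rewrite !trmx_mul trmxK psd_sym // mulmxA.
Qed.

Lemma psd_mxdiag (R : realType) (k : nat) (d : 'I_k -> nat)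
    (B : forall i, 'M[R]_(d i)) :
  (forall i, psdmx (B i)) -> psdmx (\mxdiag_i B i).
Proof.
move=> pB; apply/psdmxP; split=> [|x].
  by rewrite tr_mxdiag; apply/eq_mxdiagP => i; rewrite psd_sym.
rewrite -(submxrowK x) /quad mul_mxrow_mxdiag tr_mxrow mul_mxrow_mxcol summxE.
by apply: sumr_ge0 => i _; apply: psd_quad_ge0.
Qed.

Lemma psd_scalar (R : realType) (m : nat) (k : R) :
  0 <= k -> psdmx (k%:M : 'M[R]_m).
Proof.
move=> k0; rewrite -scalemx1; apply: psdZ => //.
apply/psdmxP; split=> [|x]; first by rewrite trmx1.
rewrite /quad mulmx1 mxE; apply: sumr_ge0 => i _.
by rewrite mxE -expr2 sqr_ge0.
Qed.

(** * Monotone affine operators on tuples *)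

Section AffineIteration.
Context (R : realType) (I : finType) (m : nat).
Variables (a : I -> I -> R) (M G : I -> 'M[R]_m) (w : I -> R).
Hypothesis a_ge0 : forall i j, 0 <= a i j.
Hypothesis G_psd : forall j, psdmx (G j).
Hypothesis w_gt0 : forall j, 0 < w j.
Implicit Types P Q : I -> 'M[R]_m.

(** Abstract form of the operator: [a i j] stands for [p_ij pi_i / pi_j], [M j] for [F_j Abar], and
    [G j] collects the noise terms, which do not depend on [P]. *)
Definition lyap P : I -> 'M[R]_m := fun j =>
  \sum_i a i j *: (M j *m P i *m (M j)^T) + G j.

Lemma quad_lyap P j x :
  quad (lyap P j) x = \sum_i a i j * quad (P i) (x *m M j) + quad (G j) x.
Proof.
rewrite quadD quad_sum; congr (_ + _); apply: eq_bigr => i _.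
by rewrite quadZ quad_conj.
Qed.

Lemma lyap_sym P : (forall j, (P j)^T = P j) ->
  forall j, (lyap P j)^T = lyap P j.
Proof.
move=> sP j; rewrite linearD /= (psd_sym (G_psd j)) linear_sum /=.
congr (_ + _); apply: eq_bigr => i _.
by rewrite linearZ /= !trmx_mul trmxK sP mulmxA.
Qed.

Lemma iter_lyap_sym P t : (forall j, (P j)^T = P j) ->
  forall j, (iter t lyap P j)^T = iter t lyap P j.
Proof. by move=> sP; elim: t => //= t IH; apply: lyap_sym. Qed.

(** [G] cancels in differences, leaving a linear map with nonnegative coefficients. The factor [k]
    covers two uses: [k = 0] gives monotonicity, and a general [k] gives the upper bound in the
    final squeeze. *)
Lemma lyap_diff_le k P Q P' Q' :
  (forall j x, quad (P j) x - quad (Q j) x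
     <= k * (quad (P' j) x - quad (Q' j) x)) ->
  forall j x, quad (lyap P j) x - quad (lyap Q j) x
     <= k * (quad (lyap P' j) x - quad (lyap Q' j) x).
Proof.
move=> le j x; have cancel (b c d : R) : b + d - (c + d) = b - c by ring.
rewrite !quad_lyap !cancel -!sumrB mulr_sumr.
apply: ler_sum => i _; rewrite -!mulrBr mulrCA; exact: ler_wpM2l.
Qed.

Lemma iter_lyap_diff_le k P Q P' Q' t :
  (forall j x, quad (P j) x - quad (Q j) x
     <= k * (quad (P' j) x - quad (Q' j) x)) ->
  forall j x, quad (iter t lyap P j) x - quad (iter t lyap Q j) x
     <= k * (quad (iter t lyap P' j) x - quad (iter t lyap Q' j) x).
Proof. by move=> le; elim: t => //= t IH; apply: lyap_diff_le. Qed.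

Lemma iter_lyap_le P Q t :
  (forall j x, quad (P j) x <= quad (Q j) x) ->
  forall j x, quad (iter t lyap P j) x <= quad (iter t lyap Q j) x.
Proof.
move=> PQ j x; rewrite -subr_le0.
(* With factor 0 the second pair of tuples is a mere placeholder. *)
rewrite (le_trans (@iter_lyap_diff_le 0 _ _ P Q t _ j x)) ?mul0r // => k y.
by rewrite mul0r subr_le0.
Qed.

Lemma lyap_le P Q : (forall j x, quad (P j) x <= quad (Q j) x) ->
  forall j x, quad (lyap P j) x <= quad (lyap Q j) x.
Proof. exact: (@iter_lyap_le P Q 1). Qed.

Lemma cvg_quad_lyap (u : nat -> I -> 'M[R]_m) P :
  (forall j x, quad (u t j) x @[t --> \oo] --> quad (P j) x) ->
  forall j x, quad (lyap (u t) j) x @[t --> \oo] --> quad (lyap P j) x.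
Proof.
move=> uP j x; rewrite quad_lyap; under eq_cvg do rewrite quad_lyap.
apply: cvgD; last exact: cvg_cst.
by apply: cvg_sumr => i; apply: cvgMl_tmp.
Qed.

Lemma mxle_lyapP P : (forall j, (P j)^T = P j) ->
  (forall j, mxle (lyap P j - P j) 0) <->
  forall j x, quad (lyap P j) x <= quad (P j) x.
Proof.
move=> sP; split=> [le j x|le j].
  have := psd_quad_ge0 x (le j).
  by rewrite sub0r opprB quadD quadN subr_ge0.
apply/psdmxP; split=> [|x]; last by rewrite sub0r opprB quadD quadN subr_ge0.
by rewrite !linearB /= linear0 lyap_sym // sP.
Qed.

(** * Consequences of minimality and convergence of the iterates *)

Variable Pb : I -> 'M[R]_m.
Hypothesis Pb_pd : forall j, pdmx (Pb j).
Hypothesis Pb_lyap : forall j, mxle (lyap Pb j - Pb j) 0.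
Hypothesis Pb_min : forall P, (forall j, pdmx (P j)) ->
  (forall j, mxle (lyap P j - P j) 0) ->
  \tr (\sum_j w j *: Pb j) <= \tr (\sum_j w j *: P j).

Let Pb_sym j : (Pb j)^T = Pb j. Proof. exact/psd_sym/pd_psd. Qed.

Let Pb_le j x : quad (lyap Pb j) x <= quad (Pb j) x.
Proof. by move: j x; apply/mxle_lyapP. Qed.

(* [Q] may be singular, hence infeasible; the midpoint of [Q] and [Pb] is
   feasible and cheaper than [Pb] unless [Q = Pb]. *)
Lemma minimal_eq Q : (forall j, psdmx (Q j)) ->
  (forall j x, quad (lyap Q j) x <= quad (Q j) x) ->
  (forall j x, quad (Q j) x <= quad (Pb j) x) -> Q = Pb.
Proof.
move=> pQ leQ QPb; pose P j := 2^-1 *: (Pb j + Q j).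
have quadP j x : quad (P j) x = (quad (Pb j) x + quad (Q j) x) / 2.
  by rewrite quadZ quadD mulrC.
have sP j : (P j)^T = P j.
  by rewrite linearZ linearD /= Pb_sym (psd_sym (pQ j)).
have pP j : pdmx (P j).
  split=> [|x x0]; first exact/symmetricmxP.
  rewrite -/(quad (P j) x) quadP divr_gt0 // ltr_wpDr //.
    exact: psd_quad_ge0.
  by case: (Pb_pd j) => _; apply.
have leP j x : quad (lyap P j) x <= quad (P j) x.
  (* An affine map sends midpoints to midpoints. *)
  have -> : quad (lyap P j) x = (quad (lyap Pb j) x + quad (lyap Q j) x) / 2.
    rewrite !quad_lyap addrACA -big_split mulrDl mulr_suml /=; congr (_ + _); last by field.
    by apply: eq_bigr => i _; rewrite quadP; field.
  by rewrite quadP ler_wpM2r // ?invr_ge0 // lerD.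
have pD j : psdmx (Pb j - Q j).
  apply/psdmxP; split=> [|x]; last by rewrite quadD quadN subr_ge0.
  by rewrite linearB /= Pb_sym (psd_sym (pQ j)).
have wD j : 0 <= w j * \tr (Pb j - Q j).
  by rewrite mulr_ge0 ?psd_trace_ge0 // ltW.
(* The cost of [Pb] is at most that of the midpoint, the average of the costs of [Pb] and [Q]; hence
   [Pb] costs no more than [Q]. *)
have le0 : \sum_j w j * \tr (Pb j - Q j) <= 0.
  have := Pb_min pP ((mxle_lyapP sP).2 leP).
  have costE S : \tr (\sum_j w j *: S j) = \sum_j w j * \tr (S j).
    by rewrite raddf_sum; apply: eq_bigr => j _; rewrite /= mxtraceZ.
  have -> : \sum_j w j * \tr (Pb j - Q j)
      = \sum_j w j * \tr (Pb j) - \sum_j w j * \tr (Q j).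
    by rewrite -sumrB; apply: eq_bigr => j _; rewrite linearB /= mulrBr.
  have midE : \sum_j w j * \tr (P j)
      = (\sum_j w j * \tr (Pb j) + \sum_j w j * \tr (Q j)) / 2.
    rewrite -big_split mulr_suml; apply: eq_bigr => j _ /=.
    by rewrite mxtraceZ mxtraceD; field.
  by rewrite !costE midE; lra.
have /psumr_eq0P eq0 : \sum_j w j * \tr (Pb j - Q j) = 0.
  by apply: le_anti; rewrite le0 sumr_ge0.
apply: funext => j; apply/esym/eqP; rewrite -subr_eq0; apply/eqP.
apply: psd_trace0 => //; apply/eqP.
have /eqP := eq0 (fun i _ => wD i) j isT.
by rewrite mulf_eq0 gt_eqF.
Qed.

Lemma lyap_psd P : (forall j, psdmx (P j)) -> forall j, psdmx (lyap P j).
Proof.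
move=> pP j; apply: psdD => //; apply: psd_sum => i.
by apply: psdZ => //; apply: psd_conj.
Qed.

Lemma minimal_fixed : lyap Pb = Pb.
Proof.
apply: minimal_eq => //; last exact: lyap_le.
by apply: lyap_psd => j; apply: pd_psd.
Qed.

Lemma iter_lyap0_cvg j x :
  quad (iter t lyap (fun=> 0) j) x @[t --> \oo] --> quad (Pb j) x.
Proof.
pose u t := iter t lyap (fun=> 0).
have pu t : forall i, psdmx (u t i).
  by elim: t => [i|t] /=; [exact: psd0|exact: lyap_psd].
have le0 P : (forall i, psdmx (P i)) ->
    forall i y, quad (0 : 'M[R]_m) y <= quad (P i) y.
  by move=> pP i y; rewrite quad0 psd_quad_ge0.
(* The extra application is moved innermost: [u t.+1] is the [t]-th iterate started at [u 1], which
   dominates the zero tuple. *)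
have u_nd t i y : quad (u t i) y <= quad (u t.+1 i) y.
  by rewrite /u iterSr; apply: iter_lyap_le; exact: (le0 _ (pu 1)).
have u_le t i y : quad (u t i) y <= quad (Pb i) y.
  have <- : iter t lyap Pb = Pb by elim: t => //= t ->; exact: minimal_fixed.
  by apply: iter_lyap_le; apply: le0 => k; apply: pd_psd.
have /choice[Q QP] (i : I) : exists S, S^T = S /\
    forall y, quad (u t i) y @[t --> \oo] --> quad S y.
  have [S sS uS] := nondecreasing_quad_limit (fun t => psd_sym (pu t i))
    (fun t => u_nd t i) (fun t => u_le t i).
  by exists S.
have uQ i y : quad (u t i) y @[t --> \oo] --> quad (Q i) y by have [_] := QP i.
suff <- : Q = Pb by exact: uQ.
(* The shifted sequence tends to the form of [lyap Q] by continuity and to that of [Q] as a shift of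
   [u]. *)
have EQ i y : quad (lyap Q i) y = quad (Q i) y.
  have uS : quad (lyap (u t) i) y @[t --> \oo] --> quad (Q i) y.
    by have := uQ i y; rewrite -(cvg_shiftS (fun t => quad (u t i) y)).
  apply: (cvg_unique _ (cvg_quad_lyap (j := i) (x := y) uQ) uS).
  exact: norm_hausdorff.
apply: minimal_eq => [i|i y|i y].
- apply/psdmxP; split=> [|y]; first by have [] := QP i.
  by apply: cvgr_to_ge (uQ i y) _; apply: nearW => t; apply: psd_quad_ge0.
- by rewrite EQ.
- by apply: cvgr_to_le (uQ i y) _; apply: nearW.
Qed.

Lemma iter_lyap_cvg P : (forall j, psdmx (P j)) ->
  forall j, iter t lyap P j @[t --> \oo] --> Pb j.
Proof.
move=> pP j; apply: cvg_quad_mx => // [t|x].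
  by apply: iter_lyap_sym => i; apply: psd_sym.
(* One constant per index; their sum later serves all indices at once. *)
have /choice[k kP] (i : I) : exists k, 0 <= k /\
    forall y, quad (P i) y <= k * quad (Pb i) y.
  by have [k k0 kP] := pd_dominates (P i) (Pb_pd i); exists k.
pose u t := quad (iter t lyap (fun=> 0) j) x.
have u_cvg : u t @[t --> \oo] --> quad (Pb j) x by exact: iter_lyap0_cvg.
have lower t : u t <= quad (iter t lyap P j) x.
  by apply: iter_lyap_le => i y; rewrite quad0 psd_quad_ge0.
have upper t : quad (iter t lyap P j) x
    <= u t + (\sum_i k i) * (quad (Pb j) x - u t).
  rewrite -lerBlDl.
  (* Viewing [Pb] as its own [t]-th iterate turns the bound into a comparison of iterates, both
     differences being taken against the iterates of 0. *)
  have {1}<- : iter t lyap Pb = Pb by elim: t => //= t ->; exact: minimal_fixed.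
  apply: iter_lyap_diff_le => i y; rewrite quad0 !subr0.
  apply: le_trans ((kP i).2 y) _; rewrite ler_wpM2r ?psd_quad_ge0 //.
    exact: pd_psd.
  rewrite (bigD1 i) //= lerDl sumr_ge0 // => l _.
  by have [] := kP l.
apply: (@squeeze_cvgr _ \oo _ R u _ _ _ _ u_cvg).
  by apply: nearW => t; rewrite lower; exact: upper.
have gap : quad (Pb j) x - u t @[t --> \oo] --> quad (Pb j) x - quad (Pb j) x.
  by apply: cvgB u_cvg; exact: cvg_cst.
rewrite subrr in gap.
have : u t + (\sum_i k i) * (quad (Pb j) x - u t) @[t --> \oo]
    --> quad (Pb j) x + (\sum_i k i) * 0.
  by apply: cvgD u_cvg _; apply: cvgMl_tmp gap.
by rewrite mulr0 addr0.
Qed.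

End AffineIteration.

Unset Implicit Arguments.

(** * Application to the estimation error operator *)

Theorem theorem3 (R : realType) (n nw ny dbar : nat)
    (A : 'M[R]_n) (Bw : 'M[R]_(n, nw)) (c : 'I_ny -> 'rV[R]_n)
    (W : 'M[R]_nw) (sigma : 'I_ny -> R)
    (disp : measure_display) (Om : measurableType disp)
    (Pr : probability Om R)
    (tau : 'I_ny -> int -> Om -> option 'I_dbar.+1)
    (beta : 'I_ny -> 'I_dbar.+1 -> R)
    (p : state ny dbar -> state ny dbar -> R) (pi : state ny dbar -> R)
    (constr : gains R n ny dbar -> Prop)
    (L : gains R n ny dbar) (Pbar : tuples R n ny dbar) :
  psdmx W ->
  delay_assumption Pr tau beta ->
  transition_probabilities Pr tau p ->
  ergodic p ->
  stationary p pi ->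
  solves A Bw c W sigma p pi constr L Pbar ->
  let E := Eop A Bw c W sigma p pi L in
  [/\ forall P0 : tuples R n ny dbar, (forall j, psdmx (P0 j)) ->
        forall j, (fun t : nat => iter t E P0 j) @ \oo --> Pbar j,
      forall j, psdmx (Pbar j),
      Pbar = E Pbar
    & forall P : tuples R n ny dbar,
        solves A Bw c W sigma p pi constr L P -> P = Pbar].
Proof.
move=> pW _ pcond _ [pi0 _ _] sol E.
(* A quotient of probabilities is nonnegative, also when the conditioning event is null, since
   division by 0 yields 0. *)
have p0 i j : 0 <= p i j.
  by rewrite (pcond 0) /cond_prob divr_ge0 // fine_ge0.
pose a i j := p i j * (pi i / pi j).
have a0 i j : 0 <= a i j by rewrite mulr_ge0 // divr_ge0 // ltW.
pose F := Fmx c L; pose X j := Xmx L j.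
pose M j := F j *m Abar dbar A.
pose G j := \sum_i a i j *: (F j *m (Bbar dbar Bw *m W *m (Bbar dbar Bw)^T)
  *m (F j)^T + X j *m Vmx dbar sigma *m (X j)^T).
have EE : E = lyap a M G.
  apply: funext => P; apply: funext => j; rewrite /E /Eop /lyap /G -big_split.
  apply: eq_bigr => i _ /=; rewrite -scalerDr addrA; congr (_ *: (_ + _)).
  by rewrite mulmxDr mulmxDl trmx_mul !mulmxA.
have V_psd : psdmx (Vmx (ny := ny) dbar sigma).
  apply: psd_mxdiag => s; apply: psd_mxdiag => d.
  by apply: psd_scalar; rewrite sqr_ge0.
have G_psd j : psdmx (G j).
  apply: psd_sum => i; apply: psdZ => //.
  by apply: psdD; apply: psd_conj => //; apply: psd_conj.
(* Stated for every minimizer with gains [L], because uniqueness applies it to a second one. *)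
have main P : solves A Bw c W sigma p pi constr L P ->
  E P = P /\ forall P0, (forall j, psdmx (P0 j)) ->
    forall j, iter t E P0 j @[t --> \oo] --> P j.
  move=> [[gL cL pP leP] minP]; rewrite EE; rewrite -/E EE in leP.
  (* Competitors keep the gains [L], so the constraints on the gain set carry over. *)
  have min Q : (forall j, pdmx (Q j)) ->
      (forall j, mxle (lyap a M G Q j - Q j) 0) ->
      \tr (\sum_j pi j *: P j) <= \tr (\sum_j pi j *: Q j).
    by move=> pQ leQ; apply: (minP L Q); split=> //; rewrite -/E EE.
  split; first exact: (minimal_fixed (w := pi)).
  exact: (iter_lyap_cvg (w := pi)).
have [Pfix Pcvg] := main Pbar sol.
have Pbar_psd j : psdmx (Pbar j) by case: sol => -[_ _ /(_ j)/pd_psd].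
split=> // P solP; have [Pfix' _] := main P solP.
have P_psd j : psdmx (P j) by case: solP => -[_ _ /(_ j)/pd_psd].
apply: funext => j.
(* Started at its fixed point [P] the iteration is constant, yet it converges to [Pbar]. *)
have iterP t : iter t E P = P by elim: t => // t IH; rewrite iterS IH.
have Pj : iter t E P j @[t --> \oo] --> P j.
  by under eq_cvg do rewrite iterP; exact: cvg_cst.
apply: (cvg_unique _ Pj (Pcvg P P_psd j)); exact: norm_hausdorff.
Qed.
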